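(* Let $m,n,\ell\ge0$ be integers such that $n+\ell\ge m$, and let $N\ge0$. The bijections $f$ (on partitions) and $\gamma$ (on lattice paths) are related by Foata's bijection $\phi^{-1}$ in the following way: for $\lambda\in\overline{\mathcal R}_{m,n}^{\ge 1-\ell}(N)$, \[ f(\lambda)=\phi\bigl(\gamma(\phi^{-1}(\lambda'))\bigr)' , \] where $'$ denotes conjugation of partitions. This is illustrated in the following commutative diagram, where $\mathrm{conj}$ denotes conjugation of partitions: \[ \begin{array}{ccccc} \overline{\mathcal R}_{m,n}^{\ge 1-\ell}(N)&\stackrel{\mathrm{conj}}{\longleftrightarrow}& \overline{\mathcal R}_{n,m}^{\le \ell-1}(N)&\stackrel{\phi^{-1}}{\longrightarrow}& \overline{\mathcal A}_{n,m}^{-\ell}(N)\\ \downarrow f &&&&\downarrow \gamma\\ \overline{\mathcal R}_{m-1,n+1}^{\ge 2-\ell}(N-1)&\stackrel{\mathrm{conj}}{\longleftrightarrow}& \overline{\mathcal R}_{n+1,m-1}^{\le \ell-2}(N-1)&\stackrel{\phi^{-1}}{\longrightarrow}&\overline{\mathcal A}_{n+1,m-1}^{-\ell+1}(N-1) \end{array} \]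
   Context: Partitions. A partition $\lambda=(\lambda_1\ge\dots\ge\lambda_k)$ is a weakly decreasing (possibly empty) sequence of positive integers; $|\lambda|=\sum_i\lambda_i$; $\lambda_i=0$ for $i>k$; its conjugate $\lambda'$ has parts $\lambda'_j=|\{i:\lambda_i\ge j\}|$. Let $d(\lambda)=\max\{i\ge1:\lambda_i\ge i\}$ ($0$ if $\lambda=\emptyset$). For $1\le i\le d(\lambda)$ the $i$th successive rank is $r_i(\lambda)=\lambda_i-\lambda'_i$. $\mathcal P_{a,b}$ is the set of partitions with at most $a$ parts and largest part at most $b$ (empty if $a<0$ or $b<0$). $\overline{\mathcal R}^{\ge c}$ (resp. $\overline{\mathcal R}^{\le c}$) is the set of partitions having at least one rank $<c$ (resp. $>c$), and $\overline{\mathcal R}^{\ast}_{a,b}=\overline{\mathcal R}^{\ast}\cap\mathcal P_{a,b}$. Appending $(N)$ to a set of partitions means restricting to $|\lambda|=N$. The map $f$. For $\lambda$ with some rank $\le0$, let $i$ be the largest index in $\{1,\dots,d(\lambda)\}$ minimizing $r_i(\lambda)$. Remove one part of size $i$ from $\lambda$ (it exists); then insert a part of size $i-1$ into the conjugate of the resulting partition (nothing if $i=1$). The partition so obtained (in the original, unconjugated orientation) is $f(\lambda)$. Words, partitions and paths. $\mathcal W_{a,b}$ is the set of words with $a$ letters $1$ and $b$ letters $2$. A partition $\lambda=(\lambda_1,\dots,\lambda_k)\in\mathcal P_{a,b}$ is identified with the word $1^{a-k}2^{\lambda_k}12^{\lambda_{k-1}-\lambda_k}1\cdots 12^{\lambda_1-\lambda_2}12^{b-\lambda_1}\in\mathcal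 W_{a,b}$ (the south-east boundary of the Young diagram in an $a\times b$ box read from lower-left to upper-right, $1$ = vertical, $2$ = horizontal). $\mathcal G_{a,b}$ is the set of lattice paths from the origin with $a$ steps $U=(1,1)$ and $b$ steps $D=(1,-1)$ (empty if $a<0$ or $b<0$); it is identified with $\mathcal W_{a,b}$ by $1\leftrightarrow U$, $2\leftrightarrow D$. A valley of a path is a vertex preceded by $D$ and followed by $U$; $\mathrm{maj}(P)$ is the sum of the $x$-coordinates of the valleys. $\overline{\mathcal A}^{c}_{a,b}$ is the set of $P\in\mathcal G_{a,b}$ having some vertex strictly below the line $y=c$. Appending $(N)$ to a set of paths means restricting to $\mathrm{maj}(P)=N$. Foata's bijection $\phi:\mathcal W_{a,b}\to\mathcal W_{a,b}$ is defined recursively by $\phi(\epsilon)=\epsilon$ ($\epsilon$ the empty word), $\phi(1)=1$, $\phi(w2)=\phi(w)2$, $\phi(w11)=1\phi(w1)$, $\phi(w21)=2\phi(w)1$. Via the identifications above, it is viewed as a bijection $\phi:\mathcal G_{a,b}\to\mathcal P_{a,b}$ with inverse $\phi^{-1}:\mathcal P_{a,b}\to\mathcal G_{a,b}$. In the claim, $\lambda'\in\mathcal P_{n,m}$, so $\phi^{-1}(\lambda')\in\mathcal G_{n,m}$; the outer $\phi$ goes from $\mathcal G_{n+1,m-1}$ to $\mathcal P_{n+1,m-1}$. The map $\gamma$. For a path $P$, let $\min(P)$ be the minimum $y$-coordinate of its vertices. If $\min(P)<0$, $\gamma(P)$ is obtained by turning the $D$ step that ends at the leftmost vertex of height $\min(P)$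 into a $U$ step.
   Formalization: For ℓ=0 the diagram's bottom row is false as written (m=n=2, λ=(2,2): f(λ)=(3) has no rank <2); there the two bottom partition sets are replaced by all partitions of N−1 in the boxes P_{m−1,n+1} and P_{n+1,m−1}. All else is as stated. *)

(* Defs.v *)
From mathcomp Require Import all_boot all_order all_algebra.
From mathcomp Require Import boolp classical_sets functions.

Set Implicit Arguments.
Unset Strict Implicit.
Unset Printing Implicit Defensive.

Import Order.TTheory GRing.Theory Num.Theory.
Local Open Scope classical_set_scope.
Local Open Scope ring_scope.

(** * Partitions, as weakly decreasing sequences of positive naturals *)

Definition is_part (la : seq nat) : bool := sorted geq la && (0%N \notin la).

(** [part la i] is the part lambda_i; indices start at 1. *)
Definition part (la : seq nat) (i : nat) : nat := nth 0%N la i.-1.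

Definition conj_part (la : seq nat) : seq nat :=
  [seq count (leq j) la | j <- iota 1 (part la 1)].

Definition durfee (la : seq nat) : nat :=
  (\max_(1 <= i < (size la).+1 | i <= part la i) i)%N.

Definition rank (la : seq nat) (i : nat) : int :=
  (part la i)%:Z - (part (conj_part la) i)%:Z.

(** The parameters [a], [b], [N] are integers: all the sets below are empty when
    one of them is negative. *)
Definition Pbox (a b : int) : set (seq nat) :=
  [set la | [/\ is_part la, (size la)%:Z <= a & (part la 1)%:Z <= b]].

Definition PboxN (a b N : int) : set (seq nat) :=
  [set la | Pbox a b la /\ (sumn la)%:Z = N].

(** [Rbar_ge a b c N] has some rank < c: it is the complement, among partitions,
    of "all ranks >= c"; dually for [Rbar_le]. *)
Definition Rbar_ge (a b c N : int) : set (seq nat) :=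
  [set la | PboxN a b N la /\
     exists2 i : nat, (1 <= i <= durfee la)%N & rank la i < c].

Definition Rbar_le (a b c N : int) : set (seq nat) :=
  [set la | PboxN a b N la /\
     exists2 i : nat, (1 <= i <= durfee la)%N & rank la i > c].

(** ** The map f *)

Definition last_argmin_rank (la : seq nat) : nat :=
  (\max_(1 <= i < (durfee la).+1
         | all (fun j => (rank la i <= rank la j)%R) (iota 1 (durfee la))) i)%N.

(** Inserting a part of size 0 does nothing. *)
Definition insert_part (p : nat) (la : seq nat) : seq nat :=
  if p is 0%N then la else sort geq (p :: la).

Definition f_map (la : seq nat) : seq nat :=
  let i := last_argmin_rank la in
  conj_part (insert_part i.-1 (conj_part (rem i la))).

(** * Words and lattice paths
    A word is a [seq bool]: [true] is the letter 1, i.e. the step U = (1,1), and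
    [false] is the letter 2, i.e. the step D = (1,-1). *)

Definition Gpath (a b : int) : set (seq bool) :=
  [set w | (count_mem true w)%:Z = a /\ (count_mem false w)%:Z = b].

(** The word 1^(a-k) 2^(la_k) 1 2^(la_(k-1)-la_k) 1 ... 2^(la_1-la_2) 1 2^(b-la_1);
    it is only meaningful for [la] in [Pbox a b], where [a] and [b] are
    nonnegative. *)
Definition word (a b : int) (la : seq nat) : seq bool :=
  nseq (`|a| - size la)%N true
  ++ flatten (pairmap (fun p q => rcons (nseq (q - p)%N false) true) 0%N (rev la))
  ++ nseq (`|b| - part la 1)%N false.

(** [height w x] is the y-coordinate of the vertex of abscissa [x]. *)
Definition height (w : seq bool) (x : nat) : int :=
  (count_mem true (take x w))%:Z - (count_mem false (take x w))%:Z.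

Definition heights (w : seq bool) : seq int :=
  [seq height w x | x <- iota 0 (size w).+1].

(** The initial value 0 of the fold is the height of the starting vertex. *)
Definition min_height (w : seq bool) : int := foldr Num.min 0 (heights w).

(** Step number [x] (from 1) ends at the vertex [x] and is [nth _ w x.-1]. *)
Definition valley (w : seq bool) (x : nat) : bool :=
  ~~ nth true w x.-1 && nth false w x.

Definition maj (w : seq bool) : nat :=
  (\sum_(1 <= x < size w | valley w x) x)%N.

Definition Abar (a b c N : int) : set (seq bool) :=
  [set w | [/\ Gpath a b w,
     (exists2 x : nat, (x <= size w)%N & height w x < c) & (maj w)%:Z = N]].

Definition gamma (w : seq bool) : seq bool :=
  if min_height w < 0
  then set_nth true w (index (min_height w) (heights w)).-1 true
  else w.

(** ** Foata's bijection
    It is defined by recursion from the right end of the word, hence on the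
    reversed word; the defining equations are proved below. *)

Fixpoint foata_rev (v : seq bool) : seq bool :=
  match v with
  | [::] => [::]
  | false :: v1 => rcons (foata_rev v1) false
  | true :: v1 =>
      match v1 with
      | [::] => [:: true]
      | true :: _ => true :: foata_rev v1
      | false :: v2 => false :: rcons (foata_rev v2) true
      end
  end.

Definition foata (w : seq bool) : seq bool := foata_rev (rev w).

Lemma foata0 : foata [::] = [::].
Proof. by []. Qed.

Lemma foata1 : foata [:: true] = [:: true].
Proof. by []. Qed.

Lemma foata_2 w : foata (w ++ [:: false]) = foata w ++ [:: false].
Proof. by rewrite /foata rev_cat /= cats1. Qed.

Lemma foata_11 w :
  foata (w ++ [:: true; true]) = true :: foata (w ++ [:: true]).
Proof. by rewrite /foata !rev_cat. Qed.

Lemma foata_21 w :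
  foata (w ++ [:: false; true]) = false :: foata w ++ [:: true].
Proof. by rewrite /foata rev_cat /= cats1. Qed.

(** Through the identification of [Pbox a b] with [Gpath a b] given by
    [word a b], Foata's bijection is a map [phi] from [Gpath a b] to [Pbox a b],
    and [phi_inv] is its inverse. *)
Definition phi (a b : int) (w : seq bool) : seq nat :=
  'pinv_(fun=> [::]) (Pbox a b) (word a b) (foata w).

Definition phi_inv (a b : int) (la : seq nat) : seq bool :=
  'pinv_(fun=> [::]) (Gpath a b) foata (word a b la).

(* Main.v *)
Require Import Defs.
From mathcomp Require Import all_boot all_order all_algebra.
From mathcomp Require Import boolp classical_sets functions.
From mathcomp Require Import zify.
Import Order.TTheory GRing.Theory Num.Theory.

(** Under [phi], a path whose valleys are the points reached after [a_k] steps
    [U] and [b_k] steps [D] (listed from right to left, [k = 0, 1, ...])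
    corresponds to the partition [mu] with Frobenius coordinates
    [(b_0 - 1, b_1 - 1, ... | a_0, a_1, ...)].  Indeed Foata's recursion
    [phi (w 2 1) = 2 (phi w) 1] adds an outer hook around the diagram of [phi w],
    while [phi (w 2) = (phi w) 2] and [phi (w 1 1) = 1 (phi (w 1))] do not change
    the diagram.  Hence the successive ranks of [mu] are [b_k - a_k - 1], i.e.
    minus one minus the heights of the valleys, and the size of [mu] is the major
    index of the path.  When the path goes below the line [y = - l] its minimum is
    reached at a valley, and the leftmost minimum is the valley [s] such that
    [s + 1] is the last index minimizing the ranks of the conjugate of [mu].  Both
    [gamma] and [f] then add one to [a_k] for [k < s] and subtract one from [b_k]
    for [k <= s]. *)

(** * Partitions *)

(** Partitions are compared cell by cell: [c < nth 0 la r] says that the diagram has a cell in row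
    [r] and column [c], both counted from 0. *)
Lemma ltn_ext (m n : nat) : (forall k, (k < m) = (k < n)) -> m = n.
Proof.
by move=> H; have := H m; have := H n; rewrite !ltnn; lia.
Qed.

Lemma geq_trans : transitive geq.
Proof. by move=> y x z /= yx zy; exact: leq_trans zy yx. Qed.

Lemma is_part_sorted la : is_part la -> sorted geq la.
Proof. by case/andP. Qed.

(** The entries greater than [c] form a prefix of a decreasing sequence, and [count] is the length
    of this prefix. *)
Lemma nth_sorted_gt (la : seq nat) r c : sorted geq la ->
  (c < nth 0 la r) = (r < count (leq c.+1) la).
Proof.
elim: la r => [|x la IH] r /=; first by rewrite nth_nil.
rewrite path_sortedE; last exact: geq_trans.
case/andP=> /allP lax sla; case: r => [|r] /=.
  case: (ltnP c x) => //= xc; symmetry; apply/negbTE.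
  rewrite -leqNgt leqn0 -leqn0 leqNgt -has_count; apply/hasPn => y /lax /= yx.
  by rewrite -leqNgt (leq_trans yx).
rewrite IH //; case: (ltnP c x) => //= xc.
rewrite add0n.
suff -> : count (leq c.+1) la = 0 by [].
apply/eqP; rewrite -leqn0 leqNgt -has_count; apply/hasPn => y /lax /= yx.
by rewrite -leqNgt (leq_trans yx).
Qed.

Lemma size_part la : is_part la -> count (leq 1) la = size la.
Proof.
case/andP=> _ la0; apply/eqP; rewrite -all_count; apply/allP => x xla.
by rewrite lt0n; apply: contraNneq la0 => <-.
Qed.

Lemma part_ext la mu : is_part la -> is_part mu ->
  (forall r, nth 0 la r = nth 0 mu r) -> la = mu.
Proof.
move=> pla pmu H; have sz : size la = size mu.
  apply: ltn_ext => k; rewrite -!size_part //.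
  by rewrite -!nth_sorted_gt ?H //; exact: is_part_sorted.
exact: (@eq_from_nth _ 0).
Qed.

Lemma nth_conj la k : sorted geq la ->
  nth 0 (conj_part la) k = count (leq k.+1) la.
Proof.
move=> sla; rewrite /conj_part /part /=.
case: (ltnP k (nth 0 la 0)) => kn.
  by rewrite (nth_map 0) ?size_iota // nth_iota // add1n.
rewrite nth_default ?size_map ?size_iota //.
by move: kn; rewrite leqNgt nth_sorted_gt // lt0n negbK => /eqP.
Qed.

Lemma nth_conj_gt la r c : is_part la ->
  (c < nth 0 (conj_part la) r) = (r < nth 0 la c).
Proof. by case/andP=> sla _; rewrite nth_conj // nth_sorted_gt. Qed.

Lemma conj_is_part la : sorted geq la -> is_part (conj_part la).
Proof.
move=> sla; apply/andP; split.
  rewrite sorted_map; apply: (@sub_sorted _ leq).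
    move=> i j /= ij; apply: sub_count => x /=; exact: leq_trans.
  exact: iota_sorted.
apply/mapP => -[j]; rewrite mem_iota add1n ltnS /part /= => /andP[j0 j1].
case: j j0 j1 => // j _ j1.
by apply/eqP; rewrite eq_sym -lt0n -nth_sorted_gt.
Qed.

Lemma conjK la : is_part la -> conj_part (conj_part la) = la.
Proof.
move=> pla; have sla := is_part_sorted _ pla; apply: part_ext => //.
  exact/conj_is_part/is_part_sorted/conj_is_part.
move=> r; apply: ltn_ext => k; rewrite nth_conj_gt ?conj_is_part //.
exact: nth_conj_gt.
Qed.

Lemma conj_size la : size (conj_part la) = part la 1.
Proof. by rewrite size_map size_iota. Qed.

Lemma conj_part1 la : is_part la -> part (conj_part la) 1 = size la.
Proof. by move=> pla; rewrite -conj_size conjK. Qed.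

Lemma conj_sumn la : is_part la -> sumn (conj_part la) = sumn la.
Proof.
move=> pla; have sla := is_part_sorted _ pla.
have E : all (geq (part la 1)) la.
  case: la sla {pla} => //= x la; rewrite (path_sortedE geq_trans) /part /= leqnn.
  by case/andP.
(* From here [M] is any upper bound on the parts, which allows induction on [la]: a part [x] puts
   one cell in each of the first [x] of the [M] columns. *)
rewrite /conj_part; move: (part la 1) E => M.
move=> {pla sla}; elim: la => [|x la IH] /=.
  by move=> _; elim: (iota 1 M) => //= ? ? ->.
case/andP=> xM /IH <-; rewrite sumnE big_map.
rewrite big_split /= sumnE big_map; congr (_ + _)%N.
by rewrite -big_mkcond /= sum1_count -(subnKC xM) iotaD count_cat addnC;
  rewrite (eq_in_count (a2 := pred0)) ?count_pred0 ?add0n ?(eq_in_count (a2 := predT))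
     ?count_predT ?size_iota // => k; rewrite mem_iota /=; lia.
Qed.

Lemma bigmax_last (P : pred nat) n k : P k -> 0 < k < n ->
  (forall i, k < i < n -> ~~ P i) -> \max_(1 <= i < n | P i) i = k.
Proof.
move=> Pk kn H; apply/eqP; rewrite eqn_leq; apply/andP; split.
  apply/bigmax_leqP_seq => i; rewrite mem_index_iota => ii Pi.
  rewrite leqNgt; apply/negP => ki; have := H i.
  by rewrite Pi ki; case/andP: ii => _ -> /= /(_ isT).
by apply: leq_bigmax_seq => //; rewrite mem_index_iota.
Qed.

Lemma durfee_gt la r : is_part la -> (r < durfee la) = (r < nth 0 la r).
Proof.
move=> pla; have sla := is_part_sorted _ pla.
(* The diagonal cells of a diagram form an initial segment, so the maximum in [durfee] counts
   them. *)
have D i j : i <= j -> j < nth 0 la j -> i < nth 0 la i.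
  move=> ij; rewrite !nth_sorted_gt // => /(leq_ltn_trans ij) H.
  apply: (leq_trans H); apply: sub_count => x /=; lia.
have S i : i < nth 0 la i -> i < size la.
  by case: (ltnP i (size la)) => // si; rewrite nth_default.
case: (boolP (r < nth 0 la r)) => Hr.
  rewrite /durfee; apply: (@leq_bigmax_seq _ _ _ id r.+1) => //.
  by rewrite mem_index_iota /= ltnS S.
apply/negbTE; rewrite -leqNgt; apply/bigmax_leqP_seq => i _ /= Hi.
rewrite leqNgt; apply: contra Hr => ri.
apply: (D r i.-1); first lia.
by case: i ri Hi.
Qed.

Lemma durfee_conj la : is_part la -> durfee (conj_part la) = durfee la.
Proof.
move=> pla; apply: ltn_ext => r.
by rewrite !durfee_gt ?nth_conj_gt // conj_is_part // is_part_sorted.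
Qed.

Lemma rank_conj la i : is_part la -> rank (conj_part la) i = (- rank la i)%R.
Proof. by move=> pla; rewrite /rank conjK // opprB. Qed.

(** * Words and partitions *)

(* The numbers [k + #(letters 2 before it)] of the letters 1 of [u], from the
   last letter 1 to the first. *)
Fixpoint word_parts (k : nat) (u : seq bool) : seq nat :=
  match u with
  | [::] => [::]
  | true :: u1 => rcons (word_parts k u1) k
  | false :: u1 => word_parts k.+1 u1
  end.

Lemma word_parts_cat k u v :
  word_parts k (u ++ v) = word_parts (k + count_mem false u) v ++ word_parts k u.
Proof.
elim: u k => [|[] u IH] k /=; first by rewrite addn0 cats0.
  by rewrite IH add0n rcons_cat.
by rewrite IH addSnnS.
Qed.

Lemma size_word_parts k u : size (word_parts k u) = count_mem true u.
Proof. by elim: u k => [|[] u IH] k //=; rewrite ?size_rcons IH. Qed.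

Lemma word_parts_ge k u : all (leq k) (word_parts k u).
Proof.
elim: u k => [|[] u IH] k //=; first by rewrite all_rcons leqnn IH.
by apply: sub_all (IH k.+1) => x; exact: ltnW.
Qed.

Lemma word_parts_le k u : all (geq (k + count_mem false u)) (word_parts k u).
Proof.
elim: u k => [|[] u IH] k //=; last by rewrite addnA addn1.
by rewrite all_rcons /= add0n leq_addr IH.
Qed.

Lemma word_parts_sorted k u : sorted geq (word_parts k u).
Proof.
elim: u k => [|[] u IH] k //=.
rewrite -[rcons _ _]revK rev_rcons rev_sorted /= (path_sortedE); last first.
  by move=> y x z /=; exact: leq_trans.
by rewrite all_rev word_parts_ge rev_sorted IH.
Qed.

Lemma word_partsS k u : word_parts k.+1 u = map S (word_parts k u).
Proof. by elim: u k => [|[] u IH] k //=; rewrite IH ?map_rcons. Qed.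

(** The letters 2 after the last 1 leave no trace in [word_parts], hence the assumption on their
    number. The first letter is 1 exactly when [k] is an entry. *)
Lemma word_parts_inj k u v : count_mem false u = count_mem false v ->
  word_parts k u = word_parts k v -> u = v.
Proof.
have N w : k \notin word_parts k.+1 w.
  by apply/negP => /(allP (word_parts_ge _ _)); rewrite /= ltnn.
elim: u v k N => [|x u IH] [|y v] k N.
- by [].
- by case: y => //= _ /(congr1 size); rewrite size_rcons.
- by case: x => //= _ /(congr1 size); rewrite size_rcons.
case: x y => [] [] /=.
- by rewrite !add0n => E /rcons_inj [E']; rewrite (IH _ _ N E E').
- by move=> _ H; have := N v; rewrite -H mem_rcons inE eqxx.
- by move=> _ H; have := N u; rewrite H mem_rcons inE eqxx.
move=> [E] E'; congr cons; apply: (IH _ k.+1) => // w.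
by apply/negP => /(allP (word_parts_ge _ _)); rewrite /= ltnn.
Qed.

Lemma word_parts_nseqF k n : word_parts k (nseq n false) = [::].
Proof. by elim: n k => /=. Qed.

Lemma word_parts_nseqT k n : word_parts k (nseq n true) = nseq n k.
Proof. by elim: n => //= n ->; elim: n => //= n ->. Qed.

(** Any start [p] is allowed so that the induction can run along [s], a reversed partition: the
    block of [q] raises the number of letters 2 from [p] to [q] just before its letter 1. *)
Lemma word_mid p s : path leq p s ->
  let u := flatten (pairmap (fun p q => rcons (nseq (q - p) false) true) p s) in
  word_parts p u = rev s /\ p + count_mem false u = last p s.
Proof.
elim: s p => [|q s IH] p /=; first by rewrite addn0.
case/andP=> pq /IH [IH1 IH2].
have E : p + count_mem false (rcons (nseq (q - p) false) true) = q.
  by rewrite -cats1 count_cat count_nseq /=; lia.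
rewrite word_parts_cat E IH1 count_cat addnA E IH2; split=> //.
rewrite rev_cons -!cats1; congr (_ ++ _).
rewrite word_parts_cat /= count_nseq /= mul1n subnKC //.
by rewrite word_parts_nseqF.
Qed.

Lemma rev_path la : sorted geq la -> path leq 0 (rev la).
Proof.
move=> sla; rewrite path_sortedE; last exact: leq_trans.
by rewrite rev_sorted; apply/andP; split=> //; apply/allP.
Qed.

Lemma last_rev (la : seq nat) : last 0 (rev la) = part la 1.
Proof. by case: la => //= x la; rewrite rev_cons last_rcons. Qed.

(** The zeros come from the leading letters 1 of the word, which have no letter 2 before them. *)
Lemma word_parts_word a b la : is_part la ->
  word_parts 0 (word a b la) = la ++ nseq (`|a| - size la) 0.
Proof.
move=> /is_part_sorted/rev_path/word_mid [E _].
by rewrite /word !word_parts_cat count_nseq /= E revK word_parts_nseqF word_parts_nseqT.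
Qed.

Lemma word_path a b : set_fun (Pbox a b) (Gpath a b) (word a b).
Proof.
move=> la [pla sa pb]; split.
  rewrite -(size_word_parts 0) word_parts_word // size_cat size_nseq; lia.
rewrite /word !count_cat !count_nseq /= mul1n.
have [_] := word_mid _ _ (rev_path _ (is_part_sorted _ pla)).
rewrite last_rev add0n => ->; lia.
Qed.

Lemma filter_part la n : is_part la -> [seq x <- la ++ nseq n 0 | 0 < x] = la.
Proof.
case/andP=> _ la0; rewrite filter_cat filter_nseq /= cats0.
apply/all_filterP/allP => x xla; rewrite lt0n.
by apply: contraNneq la0 => <-.
Qed.

Lemma sorted_filter0 s : sorted geq s ->
  s = [seq x <- s | 0 < x] ++ nseq (size s - size [seq x <- s | 0 < x]) 0.
Proof.
elim: s => //= x s IH; rewrite (path_sortedE geq_trans) => /andP[/allP sx ss].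
case: (ltnP 0 x) => x0 /=; first by rewrite subSS -IH.
have s0 y : y \in s -> y = 0 by move=> /sx /= yx; lia.
have -> : [seq y <- s | 0 < y] = [::].
  by rewrite (eq_in_filter (a2 := pred0)) ?filter_pred0 // => y /s0 ->.
rewrite subn0 /=; congr cons; first lia.
by apply/all_pred1P/allP => y /s0 ->.
Qed.

Lemma word_bij a b : set_bij (Pbox a b) (Gpath a b) (word a b).
Proof.
split; first exact: word_path.
- move=> la mu /set_mem [pla _ _] /set_mem [pmu _ _] /(congr1 (word_parts 0)).
  rewrite !word_parts_word // => /(congr1 (filter (leq 1))).
  by rewrite !filter_part.
(* The preimage of [u] consists of the nonzero entries of [word_parts 0 u]. *)
move=> u [ua ub]; pose s := word_parts 0 u; pose la := [seq x <- s | 0 < x].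
have ss : sorted geq s := word_parts_sorted 0 u.
have pla : is_part la.
  by rewrite /is_part sorted_filter //= ?mem_filter //; exact: geq_trans.
have szs : size la <= size s by rewrite size_filter count_size.
have Pla : Pbox a b la.
  split=> //; first by rewrite -ua -(size_word_parts 0) -/s lez_nat.
  suff : part la 1 <= count_mem false u by lia.
  rewrite /part /=; case E : la => [|x t] //=.
  have : x \in la by rewrite E mem_head.
  by rewrite mem_filter => /andP[_ /(allP (word_parts_le _ _))].
exists la => //; apply: (word_parts_inj 0).
  by have [_] := word_path _ _ _ Pla; lia.
rewrite word_parts_word // -/s [RHS]sorted_filter0 // -/la; congr (_ ++ nseq _ _).
by rewrite size_word_parts; lia.
Qed.

(** * Foata's bijection and valleys *)

(** In the clause for 11 the recursive call keeps one of the two letters, so [P] is proved for [v]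
    and [true :: v] together. *)
Lemma foata_ind (P : seq bool -> Prop) :
  P [::] -> P [:: true] ->
  (forall v, P v -> P (false :: v)) ->
  (forall v, P (true :: v) -> P [:: true, true & v]) ->
  (forall v, P v -> P [:: true, false & v]) ->
  forall v, P v.
Proof.
move=> P0 P1 P2 P11 P21 v; suff: P v /\ P (true :: v) by case.
by elim: v => [|[] v [IH1 IH2]]; split; auto.
Qed.

Lemma foata_rev11 v :
  foata_rev [:: true, true & v] = true :: foata_rev (true :: v).
Proof. by []. Qed.

Lemma foata_rev21 v :
  foata_rev [:: true, false & v] = false :: rcons (foata_rev v) true.
Proof. by []. Qed.

Lemma size_count_steps (v : seq bool) :
  size v = count_mem true v + count_mem false v.
Proof.
rewrite -(count_predC (pred1 true)); congr (_ + _).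
by apply: eq_count; case.
Qed.

Lemma count_foata_rev x v : count_mem x (foata_rev v) = count_mem x v.
Proof.
elim/foata_ind: v => [|||v IH|v IH]; first by [].
- by [].
- by move=> v IH; rewrite /= -cats1 count_cat IH /=; lia.
- rewrite foata_rev11 -cat1s -[RHS]/(count_mem x ([:: true] ++ true :: v)).
  by rewrite !count_cat IH.
by rewrite /= -cats1 count_cat IH /=; lia.
Qed.

Lemma size_foata_rev v : size (foata_rev v) = size v.
Proof.
by rewrite !size_count_steps !count_foata_rev.
Qed.

(** The last letter of the image separates the clause for 2 from those for 1; among the latter, the
    first letter of the image tells 11 from 21. Foata's recursion is inverted in this way. *)
Lemma last_foata_rev z x v : last z (foata_rev (x :: v)) = x.
Proof.
case: x => /=; last by rewrite last_rcons.
elim: v z => [|[] v IH] z //=; last by rewrite last_rcons.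
Qed.

Lemma foata_rev_inj : injective foata_rev.
Proof.
move=> v v' E.
have S : size v = size v' by rewrite -[LHS]size_foata_rev E size_foata_rev.
elim/foata_ind: v v' E S => [|||v IH|v IH].
- by case.
- by move=> [|x []] // /(congr1 (last true)); rewrite !last_foata_rev => <-.
- move=> v IH [|x v'] // E [S].
  have := congr1 (last true) E; rewrite !last_foata_rev => ?; subst x.
  by case/rcons_inj: E => /IH ->.
- move=> [|x v'] // E [S].
  have := congr1 (last true) E; rewrite !last_foata_rev => ?; subst x.
  case: v' E S => [|[] v'] //; rewrite foata_rev11 ?foata_rev11 ?foata_rev21 //.
  by move=> [E] [S]; rewrite (IH (true :: v')) //= S.
- move=> [|x v'] // E [S].
  have := congr1 (last true) E; rewrite !last_foata_rev => ?; subst x.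
  case: v' E S => [|[] v'] //; rewrite foata_rev21 ?foata_rev11 ?foata_rev21 //.
  by move=> [/rcons_inj[E]] [S]; rewrite (IH v').
Qed.

Lemma foata_rev_surj u : exists v, foata_rev v = u.
Proof.
have [n] := ubnP (size u); elim: n u => // n IH u.
case/lastP: u => [|u x]; first by exists [::].
rewrite size_rcons ltnS => un; case: x; last first.
  by have [v <-] := IH u un; exists (false :: v).
case: u un => [|[] u] /= un; first by exists [:: true].
  (* Without its first letter 1 the word still ends in 1, hence so does its preimage, and the clause
     for 11 applies. *)
  have [[|x v] E] := IH (rcons u true) ltac:(by rewrite size_rcons).
    by case: (u) E.
  have := congr1 (last true) E; rewrite last_foata_rev last_rcons => ?; subst x.
  by exists [:: true, true & v]; rewrite -E.
have [v <-] := IH u (ltnW un).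
by exists [:: true, false & v].
Qed.

Lemma foata_bij a b : set_bij (Gpath a b) (Gpath a b) foata.
Proof.
have C x w : count_mem x (foata w) = count_mem x w.
  by rewrite /foata count_foata_rev count_rev.
split.
- by move=> w [wa wb]; split; rewrite C.
- move=> w w' _ _ /foata_rev_inj; exact: (can_inj revK).
move=> u [ua ub]; have [v E] := foata_rev_surj u.
by exists (rev v); [split; rewrite -C|]; rewrite /foata revK E.
Qed.

(* The valleys of the path [rev v], from right to left, each given by the
   numbers of steps U and D that precede it. *)
Fixpoint rvalleys (v : seq bool) : seq (nat * nat) :=
  match v with
  | [::] => [::]
  | x :: v1 =>
      if x && ~~ head true v1
      then (count_mem true v1, count_mem false v1) :: rvalleys v1
      else rvalleys v1
  end.

Definition valleys (w : seq bool) : seq (nat * nat) := rvalleys (rev w).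

(* The cell [(r, c)], with indices from 0, of the partition whose [k]-th principal
   hook has an arm of [b - 1] cells and a leg of [a] cells, where [(a, b)] is the
   [k]-th entry of [V]. *)
Fixpoint hook_cell (V : seq (nat * nat)) (r c : nat) : bool :=
  match V with
  | [::] => false
  | p :: V1 =>
      match r, c with
      | 0, _ => c < p.2
      | r1.+1, 0 => r1 < p.1
      | r1.+1, c1.+1 => hook_cell V1 r1 c1
      end
  end.

(** This is the added outer hook: a new first row, and one new cell at the start of every old row,
    empty rows included. *)
Lemma word_parts_hook u :
  word_parts 0 (false :: rcons u true) =
  (count_mem false u).+1 :: map S (word_parts 0 u).
Proof. by rewrite /= -cats1 word_parts_cat /= word_partsS add1n. Qed.

Lemma word_parts_foata v r c :
  (c < nth 0 (word_parts 0 (foata_rev v)) r) = hook_cell (rvalleys v) r c.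
Proof.
elim/foata_ind: v r c => [||v IH|v IH|v IH] r c.
- by rewrite nth_nil.
- by case: r => [|[]].
- by rewrite /= -cats1 word_parts_cat.
- rewrite -[rvalleys _]/(rvalleys (true :: v)) -IH.
  (* The letter 1 put in front yields a zero part at the end, which agrees with the default value of
     [nth]. *)
  rewrite foata_rev11 /= nth_rcons; case: (ltnP r (size _)) => // H.
  by rewrite if_same nth_default.
rewrite foata_rev21 word_parts_hook.
rewrite /= add0n add1n count_foata_rev.
case: r => [|r] //=; case: (ltnP r (count_mem true v)) => rv.
  rewrite (nth_map 0) ?size_word_parts ?count_foata_rev //; case: c => //= c.
  by rewrite ltnS IH.
rewrite nth_default ?size_map ?size_word_parts ?count_foata_rev //.
by case: c => //= c; rewrite -IH nth_default // size_word_parts count_foata_rev.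
Qed.

(** The hook of a valley [(a, b)] has [a + b] cells, corner included, and [a + b] is the abscissa of
    the valley. *)
Lemma sumn_word_parts_foata v :
  sumn (word_parts 0 (foata_rev v)) = \sum_(p <- rvalleys v) (p.1 + p.2).
Proof.
elim/foata_ind: v => [|||v IH|v IH].
- by rewrite big_nil.
- by rewrite big_nil.
- by move=> v IH; rewrite /= -cats1 word_parts_cat.
- rewrite -[rvalleys _]/(rvalleys (true :: v)) -IH.
  by rewrite foata_rev11 /= sumn_rcons addn0.
rewrite foata_rev21 word_parts_hook.
rewrite /= big_cons /= -IH.
have -> s : sumn (map S s) = size s + sumn s.
  by elim: s => //= x s ->; rewrite addSn addnCA.
by rewrite size_word_parts !count_foata_rev add0n add1n addnCA addnA.
Qed.

Lemma maj_rcons w x :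
  maj (rcons w x) = maj w + (if x && ~~ last true w then size w else 0).
Proof.
rewrite /maj size_rcons; case/lastP: w => [|w y].
  by rewrite !big_geq //; case: ifP.
rewrite size_rcons big_mkcond big_nat_recr //= last_rcons -big_mkcond.
congr (_ + _).
  rewrite big_nat_cond [RHS]big_nat_cond; apply: eq_bigl => k; apply: andb_id2l => /andP[k0 k1].
  rewrite /valley [nth true (rcons _ x) _]nth_rcons [nth false (rcons _ x) _]nth_rcons.
  by rewrite size_rcons k1 ltnS (leq_trans (leq_pred _)).
rewrite /valley [nth true (rcons _ x) _]nth_rcons [nth false (rcons _ x) _]nth_rcons.
by rewrite size_rcons /= ltnSn ltnn eqxx nth_rcons ltnn eqxx andbC.
Qed.

Lemma maj_valleys w : maj w = \sum_(p <- valleys w) (p.1 + p.2).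
Proof.
rewrite /valleys -{1}(revK w); elim: (rev w) => [|x v IH] /=.
  by rewrite /maj big_geq ?big_nil.
rewrite rev_cons maj_rcons IH.
have -> : last true (rev v) = head true v.
  by case: v {IH} => //= y v; rewrite rev_cons last_rcons.
case: ifP => // _; rewrite ?addn0 // big_cons addnC size_rev; congr (_ + _) => /=.
exact: size_count_steps.
Qed.

(** * Lattice paths and the map gamma *)

(** Past the last valley both coordinates default to 0, so identities between them can be stated for
    all [k]. *)
Definition ups (V : seq (nat * nat)) k := (nth (0, 0) V k).1.
Definition downs (V : seq (nat * nat)) k := (nth (0, 0) V k).2.

(** The cell lies on the hook of index [minn r c]: in its arm if [r <= c], in its leg otherwise. *)
Lemma hook_cellE V r c :
  hook_cell V r c = if r <= c then c - r < downs V r else r - c <= ups V c.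
Proof.
elim: V r c => [|p V IH] [|r] [|c] //=; rewrite /ups /downs ?nth_nil /= ?subn0 //=.
- by case: ifP; rewrite ?ltn0 // leqn0 subn_eq0 => ->.
- by rewrite IH ltnS subSS.
Qed.

Lemma rvalleys_bound v :
  all (fun p => [&& p.1 < count_mem true v, p.2 <= count_mem false v & 0 < p.2])
    (rvalleys v).
Proof.
elim: v => //= x v IH.
have H : all (fun p => [&& p.1 < (x == true) + count_mem true v,
    p.2 <= (x == false) + count_mem false v & 0 < p.2]) (rvalleys v).
  apply: sub_all IH => p /and3P[p1 p2 ->].
  by rewrite ltn_addl // (leq_trans p2 (leq_addl _ _)).
move: H; case: ifP => //= /andP[-> hv] /= ->; rewrite andbT.
by case: v hv {IH} => [|[] v] //= _; rewrite !add0n !add1n !ltnSn.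
Qed.

Lemma rvalleys_sorted v :
  sorted (fun p q : nat * nat => (q.1 < p.1) && (q.2 < p.2)) (rvalleys v).
Proof.
elim: v => //= x v IH; case: ifP => // /andP[_].
case: v IH => [|[] v] //= IH _; rewrite path_sortedE; last first.
  by move=> q p r /andP[? ?] /andP[? ?]; apply/andP; split; lia.
rewrite IH andbT; apply: sub_all (rvalleys_bound v) => p /and3P[p1 p2 _] /=.
by rewrite !add0n add1n p1 ltnS.
Qed.

(** Between consecutive valleys the path has at least one U and one D, so both coordinates drop at
    each index. *)
Lemma valleys_gap w i j : i <= j < size (valleys w) ->
  [/\ ups (valleys w) j + (j - i) <= ups (valleys w) i,
      downs (valleys w) j + (j - i) <= downs (valleys w) i & 0 < downs (valleys w) j].
Proof.
move=> /andP[ij jd].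
have T : transitive (fun p q : nat * nat => (q.1 < p.1) && (q.2 < p.2)).
  by move=> q p r /andP[? ?] /andP[? ?]; apply/andP; split; lia.
have S k : k.+1 < size (valleys w) ->
    ups (valleys w) k.+1 < ups (valleys w) k /\ downs (valleys w) k.+1 < downs (valleys w) k.
  move=> kd; have := sorted_ltn_nth T (0, 0) (rvalleys_sorted (rev w)).
  by move/(_ k k.+1); rewrite !inE -/(valleys w) kd ltnW // ltnS leqnn => /(_ isT isT isT) /andP.
have /and3P[_ _ b0] := allP (rvalleys_bound (rev w)) _ (mem_nth (0, 0) jd).
rewrite -/(downs (valleys w) j) in b0; elim: j ij jd b0 => [|j IH] ij jd b0.
  by move: ij; rewrite leqn0 => /eqP ->; rewrite subnn !addn0.
move: ij; rewrite leq_eqVlt => /orP[/eqP ->|ij]; first by rewrite subnn !addn0.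
have [S1 S2] := S _ jd.
have [] := IH ij (ltnW jd) (leq_trans b0 (ltnW S2)).
by rewrite subSn //; split; lia.
Qed.

Lemma downs_default V k : size V <= k -> downs V k = 0.
Proof. by move=> ?; rewrite /downs nth_default. Qed.

(** * Heights of the vertices of a path *)

Lemma height0 w : height w 0 = 0%R.
Proof. by rewrite /height take0. Qed.

Lemma height_final w :
  height w (size w) = ((count_mem true w)%:Z - (count_mem false w)%:Z)%R.
Proof. by rewrite /height take_size. Qed.

Lemma height_catl p q x : x <= size p -> height (p ++ q) x = height p x.
Proof.
move=> xp; rewrite /height take_cat; case: ltnP => // px.
by rewrite (_ : x = size p) ?subnn ?take0 ?cats0 ?take_size //; lia.
Qed.

Lemma height_catr p q x :
  height (p ++ q) (size p + x) = (height p (size p) + height q x)%R.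
Proof.
rewrite height_final /height take_cat ltnNge leq_addr /= addKn !count_cat; lia.
Qed.

Lemma height_cons b q x :
  height (b :: q) x.+1 = ((if b then 1 else - 1) + height q x)%R.
Proof. by rewrite /height /=; case: b => /=; lia. Qed.

(** In [p ++ false :: q], the conditions [lowest p] and [nonneg q] say that the displayed D step
    ends at the leftmost minimum; in [p ++ true :: q], that the U step leaves the rightmost
    minimum. *)
Definition lowest (p : seq bool) := forall x, x <= size p ->
  (height p (size p) <= height p x)%R.

Definition nonneg (q : seq bool) := forall x, x <= size q ->
  (0 <= height q x)%R.

Lemma height_turn p b q x : x <= size (p ++ b :: q) ->
  (x <= size p /\ height (p ++ b :: q) x = height p x) \/
  (exists2 y, y <= size q & x = size p + y.+1 /\ height (p ++ b :: q) x =
    (height p (size p) + (if b then 1 else - 1) + height q y)%R).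
Proof.
move=> xs; case: (leqP x (size p)) => xp; [left|right].
  by rewrite height_catl.
have E : x = size p + (x - size p).-1.+1 by lia.
exists (x - size p).-1; first by move: xs; rewrite size_cat /=; lia.
by split=> //; rewrite {1}E height_catr height_cons addrA.
Qed.

(** * The leftmost minimum and the step turned by [gamma] *)

Lemma min_height_le w x : x <= size w -> (min_height w <= height w x)%R.
Proof.
move=> xw; rewrite /min_height.
have : height w x \in heights w by apply: map_f; rewrite mem_iota; lia.
elim: (heights w) => //= h s IH; rewrite inE ge_min.
by case/orP => [/eqP ->|/IH ->]; rewrite ?lexx ?orbT.
Qed.

Lemma min_height_mem w : min_height w \in heights w.
Proof.
have : height w 0 \in heights w by apply: map_f; rewrite mem_iota.
rewrite height0 /min_height => h0.
suff : foldr Num.min 0%R (heights w) \in 0%R :: heights w.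
  by rewrite inE => /orP[/eqP ->|].
elim: (heights w) {h0} => //= h s IH; rewrite minEle; case: ifP => _.
  by rewrite !inE eqxx orbT.
by move: IH; rewrite !inE => /orP[->|->]; rewrite ?orbT.
Qed.

Lemma nth_heights w x : x <= size w -> nth 0%R (heights w) x = height w x.
Proof. by move=> xw; rewrite (nth_map 0) ?size_iota // nth_iota. Qed.

Lemma size_heights w : size (heights w) = (size w).+1.
Proof. by rewrite size_map size_iota. Qed.

Lemma index_nth (T : eqType) (x0 x : T) s i : i < size s -> nth x0 s i = x ->
  (forall j, j < i -> nth x0 s j != x) -> index x s = i.
Proof.
move=> si sx H; have xs : x \in s by rewrite -sx mem_nth.
case: (ltngtP (index x s) i) => // lt.
  by have := H _ lt; rewrite nth_index // eqxx.
by have := before_find x0 lt; rewrite /= sx eqxx.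
Qed.

Lemma gamma_turn p q : lowest p -> nonneg q ->
  gamma (p ++ false :: q) = p ++ true :: q /\
  min_height (p ++ false :: q) = (height p (size p) - 1)%R.
Proof.
move=> lp nq; set w := p ++ _; set t := (_ - 1)%R.
have tx : height w (size p).+1 = t.
  by rewrite /w -[(size p).+1]addn1 height_catr height_cons height0 addr0.
have sw : (size p).+1 <= size w by rewrite size_cat /= addnS ltnS leq_addr.
have minw : min_height w = t.
  apply/eqP; rewrite eq_le -{1}tx min_height_le //=.
  have /mapP[x] := min_height_mem w; rewrite mem_iota => /andP[_ xs] ->.
  have {xs} : x <= size w by lia.
  case/height_turn => [[xp ->]|[y yq [_ ->]]].
    by have := lp x xp; rewrite /t; lia.
  by have := nq y yq; rewrite /t; lia.
split=> //; have h0 := lp 0 isT; rewrite height0 in h0.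
rewrite /gamma minw ifT; last by rewrite /t; lia.
rewrite (@index_nth _ 0%R _ _ (size p).+1) ?size_heights ?nth_heights //.
  rewrite /= set_nthE size_cat /= addnS ltnS leq_addr.
  by rewrite take_size_cat // -addn1 drop_cat ltnNge leq_addr /= addKn drop1.
move=> j jp; rewrite nth_heights; last lia.
rewrite height_catl; last lia.
by have := lp j; rewrite /t; lia.
Qed.

(** The path is cut at its leftmost minimum. The step reaching it is a D, since the vertex before it
    is strictly higher. *)
Lemma min_height_turn w : (min_height w < 0)%R ->
  exists p q, [/\ w = p ++ false :: q, lowest p, nonneg q &
                  min_height w = (height p (size p) - 1)%R].
Proof.
set t := min_height w => t0; pose k := index t (heights w).
have tw := min_height_mem w; have kw : k <= size w.
  by rewrite -ltnS -size_heights index_mem.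
have hk : height w k = t by rewrite -nth_heights // nth_index.
have before j : j < k -> (t + 1 <= height w j)%R.
  move=> jk; have := before_find 0%R jk; rewrite /= nth_heights ?(ltnW (leq_trans jk _)) //.
  by have := min_height_le w j; rewrite -/t; lia.
case E : k => [|k']; first by move: hk; rewrite E height0; lia.
have hk' := before k'; have := hk; rewrite E in hk' kw *.
have Ew : w = take k' w ++ nth false w k' :: drop k'.+1 w.
  by rewrite -drop_nth // cat_take_drop.
have sp : size (take k' w) = k' by rewrite size_takel // ltnW.
have hp : height (take k' w) k' = height w k'.
  by rewrite [in RHS]Ew height_catl // sp.
have hw x : height w (k' + x.+1) = (height w k' + (if nth false w k' then 1 else -1)
     + height (drop k'.+1 w) x)%R.
  have := height_catr (take k' w) (nth false w k' :: drop k'.+1 w) x.+1.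
  by rewrite -Ew sp height_cons hp addrA.
move=> hkt; have := hw 0; rewrite addn1 height0 addr0 hkt.
have := hk' (ltnSn _); case F : (nth false w k'); first lia.
move=> _ tk'; exists (take k' w), (drop k'.+1 w); split.
- by rewrite -F.
- move=> x; rewrite sp => xk; rewrite hp.
  suff : (t + 1 <= height (take k' w) x)%R by lia.
  have -> : height (take k' w) x = height w x by rewrite [in RHS]Ew height_catl // sp.
  by apply: before; rewrite E.
- move=> x; rewrite size_drop => xq.
  have := min_height_le w (k' + x.+1); rewrite hw -/t F; lia.
by rewrite sp hp; lia.
Qed.

(** * Valleys of a concatenation and of a path with one step turned *)

Lemma valleys_rcons w x : valleys (rcons w x) =
  if x && ~~ last true w then (count_mem true w, count_mem false w) :: valleys w
  else valleys w.
Proof.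
rewrite /valleys rev_rcons /= !count_rev.
have -> // : head true (rev w) = last true w.
by case/lastP: w => // w y; rewrite rev_rcons last_rcons.
Qed.

(** The letter [true] after [p] is used twice: it decides whether the end of [p] is a valley, and at
    the head of [true :: q] it creates none. *)
Lemma valleys_cat p q : valleys (p ++ true :: q) =
  [seq (count_mem true p + v.1, count_mem false p + v.2) | v <- valleys (true :: q)]
  ++ valleys (rcons p true).
Proof.
elim/last_ind: q => [|q x IH]; first by rewrite cats1.
rewrite -rcons_cons -rcons_cat (valleys_rcons (p ++ _)) (valleys_rcons (true :: q)).
by rewrite IH last_cat /= !count_cat; case: ifP.
Qed.

Lemma height_valley w v : v \in valleys w ->
  exists2 x, x <= size w & height w x = (v.1%:Z - v.2%:Z)%R.
Proof.
elim/last_ind: w => [|w b IH] //; rewrite valleys_rcons size_rcons => vw.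
have {vw} [/eqP ->|/IH[x xw <-]] :
    v == (count_mem true w, count_mem false w) \/ v \in valleys w.
- by move: vw; case: ifP => _; [rewrite inE => /orP|right].
- exists (size w); first exact: leqnSn.
  by rewrite -cats1 height_catl // height_final.
- by exists x; [exact: leqW|rewrite -cats1 height_catl].
Qed.

(** A lowest vertex is a valley or an endpoint of the path. Here [c <= 0] rules out the origin, and
    the second alternative is the final vertex. *)
Lemma low_vertex_valley w (c : int) x : (c <= 0)%R -> x <= size w -> (height w x < c)%R ->
  (exists2 v, v \in valleys w & (v.1%:Z - v.2%:Z < c)%R) \/
  ~~ last true w /\ (height w (size w) < c)%R.
Proof.
move=> c0; elim/last_ind: w x => [|w b IH] x.
  by rewrite leqn0 => /eqP ->; rewrite height0; lia.
rewrite size_rcons last_rcons valleys_rcons => xw hx.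
have hf : height (rcons w b) (size w).+1 =
    (height w (size w) + (if b then 1 else -1))%R.
  by rewrite -cats1 -[(size w).+1]addn1 height_catr height_cons height0 addr0.
have H : (exists2 x, x <= size w & (height w x < c)%R) \/ ~~ b /\
    (height (rcons w b) (size w).+1 < c)%R.
  move: xw; rewrite leq_eqVlt => /orP[/eqP xE|xw]; last first.
    by left; exists x => //; rewrite -[height w x](height_catl _ [:: b]) // cats1.
  case: b hf hx => hf hx; last by right; rewrite -xE.
  left; exists (size w) => //; move: hx; rewrite xE hf; lia.
case: H => [[y yw /(IH _ yw)]|]; last by right.
case=> [[v vw vc]|[lw hw]].
  by left; exists v => //; case: ifP => //; rewrite inE vw orbT.
case: b hf {hx} => hf; last by right; rewrite hf; split=> //; lia.
left; exists (count_mem true w, count_mem false w).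
  by rewrite lw inE eqxx.
by rewrite -height_final.
Qed.

Lemma lowest_last p : lowest p -> p = [::] \/ ~~ last true p.
Proof.
case/lastP: p => [|p x] lp; [by left|right]; rewrite last_rcons.
have := lp (size p); rewrite size_rcons leqnSn -cats1 => /(_ isT).
rewrite -[(size p).+1]addn1 height_catr height_cons height0 height_catl //.
by case: x {lp} => //; lia.
Qed.

(** Turning the D moves its valley back by that step, to the end of [p]. Later valleys trade one D
    for one U and earlier ones stay. For empty [p] the valley disappears. *)
Lemma valleys_turnE p q : lowest p ->
  let a := count_mem true p in
  let b := count_mem false p in
  let U := valleys (true :: q) in
  valleys (p ++ [:: false, true & q]) =
    [seq (a + v.1, b.+1 + v.2) | v <- U] ++ (a, b.+1) :: valleys p /\
  valleys (p ++ [:: true, true & q]) =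
    [seq (a.+1 + v.1, b + v.2) | v <- U] ++
    (if p == [::] then [::] else (a, b) :: valleys p).
Proof.
move=> lp a b U.
have cr x y : count_mem x (rcons p y) = count_mem x p + (y == x).
  by rewrite -cats1 count_cat /= addn0.
have Ep : valleys (rcons p true) = if p == [::] then [::] else (a, b) :: valleys p.
  rewrite valleys_rcons; case: (lowest_last p lp) => [->//|lp'].
  by rewrite lp' /= ifF //; apply: contraTF lp' => /eqP ->.
rewrite -(cat_rcons false p) -(cat_rcons true p (true :: q)) !valleys_cat.
rewrite (valleys_rcons (rcons p false)) last_rcons.
rewrite (valleys_rcons (rcons p true)) last_rcons /= Ep (valleys_rcons p).
by rewrite !cr /= !addn0 !addn1.
Qed.

(** Later valleys keep their abscissas and the moved valley loses 1; for empty [p], a valley of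
    abscissa 1 is lost. *)
Lemma maj_turn p q : lowest p ->
  maj (p ++ [:: false, true & q]) = (maj (p ++ [:: true, true & q])).+1.
Proof.
move=> /valleys_turnE H; have [E E'] := H q; rewrite !maj_valleys E E'.
rewrite !big_cat !big_map big_cons /= -addnS; congr (_ + _).
  by apply: eq_bigr => v _; lia.
case: eqP => [->|_]; first by rewrite !big_nil.
by rewrite big_cons /=; lia.
Qed.

(** The index [s] counts the valleys to the right of the turned step. The last two inequalities
    compare heights: valleys on the right are at least as high as valley [s], those on the left
    strictly higher. *)
Lemma valleys_turn p q : lowest p -> nonneg (true :: q) ->
  let V := valleys (p ++ [:: false, true & q]) in
  let V' := valleys (p ++ [:: true, true & q]) in
  exists2 s, s < size V &
  [/\ forall k, ups V' k = ups V k + (k < s),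
      forall k, downs V' k = downs V k - (k <= s),
      ups V s < downs V s,
      forall k, k < s -> ups V s + downs V k <= ups V k + downs V s &
      forall k, s < k < size V -> ups V s + downs V k < ups V k + downs V s].
Proof.
move=> lp nq V V'; set U := valleys (true :: q).
pose a := count_mem true p; pose b := count_mem false p.
have [EV EV'] := valleys_turnE p q lp.
rewrite -/a -/b -/U -/V -/V' in EV EV'.
have ab : a <= b.
  by have := lp 0 isT; rewrite height0 height_final -/a -/b; lia.
have nV k : nth (0, 0) V k = if k < size U then
    (a + ups U k, b.+1 + downs U k) else
    if k == size U then (a, b.+1) else nth (0, 0) (valleys p) (k - size U).-1.
  rewrite EV nth_cat size_map; case: ltnP => kU; first by rewrite (nth_map (0, 0)).
  case: eqP => [->|kN]; first by rewrite subnn.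
  by rewrite (_ : k - size U = (k - size U).-1.+1) //=; lia.
have nV' k : nth (0, 0) V' k = if k < size U then
    (a.+1 + ups U k, b + downs U k) else
    if k == size U then (a, b) else nth (0, 0) (valleys p) (k - size U).-1.
  rewrite EV' nth_cat size_map; case: ltnP => kU; first by rewrite (nth_map (0, 0)).
  (* When [p] is empty, the missing valley would be [(0, 0)], the default of [nth]. *)
  case: eqP => [p0|_].
    by rewrite nth_nil /a /b p0 /= nth_nil if_same.
  case: eqP => [->|kN]; first by rewrite subnn.
  by rewrite (_ : k - size U = (k - size U).-1.+1) //=; lia.
exists (size U); first by rewrite EV size_cat size_map /= addnS ltnS leq_addr.
rewrite /ups /downs.
rewrite (nV (size U)) ltnn eqxx /=.
split.
- by move=> k; rewrite nV nV'; case: ltnP => kU /=; [|case: eqP => _ /=]; lia.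
- move=> k; rewrite nV nV'; case: (ltngtP k (size U)) => kU /=; lia.
- by rewrite ltnS.
- move=> k kU; rewrite nV kU /=.
  have := mem_nth (0, 0) kU => /height_valley[x xq hx].
  by have := nq x xq; rewrite hx -/(ups U k) -/(downs U k); lia.
move=> k /andP[kU kV]; rewrite nV [k < size U]ltnNge (ltnW kU) /= gtn_eqF //=.
have kp : (k - size U).-1 < size (valleys p).
  by move: kV; rewrite EV size_cat size_map /=; lia.
have := mem_nth (0, 0) kp => /height_valley[x xp hx].
have := lp x xp; rewrite hx height_final -/a -/b.
by case: (nth _ _ _) => u v /=; lia.
Qed.

(** This prepares the inverse of [gamma]: the path is cut at its rightmost minimum, which is either
    its end or followed by a U. *)
Lemma last_minimum w : lowest w \/
  exists p q, [/\ w = p ++ true :: q, lowest p & nonneg q].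
Proof.
elim/last_ind: w => [|w b IH].
  by left=> x; rewrite leqn0 => /eqP ->.
have hf u c : height (rcons u c) (size u).+1 =
    (height u (size u) + (if c then 1 else -1))%R.
  by rewrite -cats1 -[(size u).+1]addn1 height_catr height_cons height0 addr0.
have hl u c x : x <= size u -> height (rcons u c) x = height u x.
  by move=> xu; rewrite -cats1 height_catl.
case: b; case: IH => [lw|[p [q [-> lp nq]]]].
- by right; exists w, [::]; rewrite cats1; split=> // x; rewrite leqn0 => /eqP ->.
- right; exists p, (rcons q true); rewrite rcons_cat; split=> // x.
  rewrite size_rcons leq_eqVlt => /orP[/eqP ->|xq]; last by rewrite hl // nq.
  by rewrite hf; have := nq (size q); lia.
- left=> x; rewrite size_rcons leq_eqVlt => /orP[/eqP -> //|xw].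
  by rewrite hf hl //; have := lw x xw; lia.
(* If [q] ends at height 0, the new D returns to the minimal level and the end of the path becomes
   the rightmost minimum. *)
have [q0|q0] := eqVneq (height q (size q)) 0%R; [left|right].
  move=> x; rewrite size_rcons leq_eqVlt => /orP[/eqP -> //|xw].
  rewrite hf hl // size_cat /= height_catr height_cons q0.
  case: (height_turn p true q x xw) => [[xp ->]|[y yq [_ ->]]].
    by have := lp x xp; lia.
  by have := nq y yq; lia.
exists p, (rcons q false); rewrite rcons_cat; split=> // x.
rewrite size_rcons leq_eqVlt => /orP[/eqP ->|xq]; last by rewrite hl // nq.
by rewrite hf; have := nq (size q); lia.
Qed.

Lemma turn_uniq p q p' q' : lowest p -> nonneg q -> lowest p' -> nonneg q' ->
  p ++ true :: q = p' ++ true :: q' -> p = p' /\ q = q'.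
Proof.
wlog pp : p q p' q' / size p <= size p'.
  move=> H lp nq lp' nq' E; case: (leqP (size p) (size p')) => pp; first exact: H.
  by have [] := H _ _ _ _ (ltnW pp) lp' nq' lp nq (esym E).
move=> lp nq lp' nq' E; move: pp; rewrite leq_eqVlt => /orP[/eqP|] pp.
  by move/eqP: E; rewrite eqseq_cat // eqseq_cons eqxx => /andP[/eqP -> /eqP ->].
have E1 := height_catl p' (true :: q') _ (leqnn _).
have E2 := height_catl p' (true :: q') _ (ltnW pp).
have L := lp' _ (ltnW pp); rewrite -E2 -E1 -E in L.
have S : size p' <= size (p ++ true :: q) by rewrite E size_cat leq_addr.
move: L; rewrite (height_catl p _ _ (leqnn _)).
case: (height_turn p true q _ S) => [[]|[y yq [_ ->]]]; first by rewrite leqNgt pp.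
by have := nq y yq; lia.
Qed.

Lemma nonneg_cons b q : nonneg (b :: q) -> b.
Proof.
by move=> /(_ 1 isT); rewrite height_cons height0; case: b.
Qed.

(** The final height [n - m] is at least [- l], so the minimum lies before the end and the D
    reaching it is followed by a U. *)
Lemma Abar_turn (n m l N : int) w : (0 <= l -> m <= n + l -> Abar n m (- l) N w ->
  exists p q, [/\ w = (p ++ [:: false, true & q])%SEQ, lowest p, nonneg (true :: q) &
    height p (size p) <= - l])%R.
Proof.
move=> l0 mnl [[wn wm] [x xw hx] _]; have mx := min_height_le w x xw.
have /min_height_turn[p [q [E lp nq mE]]] : (min_height w < 0)%R by lia.
case: q E nq => [|b q] E nq; last first.
  have := nonneg_cons _ _ nq; case: b E nq => // E nq _.
  by exists p, q; split=> //; lia.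
have := height_catr p [:: false] 1; rewrite height_cons height0 -E.
rewrite (_ : size p + 1 = size w); last by rewrite E size_cat.
rewrite height_final wn wm; lia.
Qed.

(** The inverse turns the U leaving the rightmost minimum into a D. *)
Lemma gamma_bij (n m l N : int) : (0 <= l -> m <= n + l ->
  set_bij (Abar n m (- l) N) (Abar (n + 1) (m - 1) (- l + 1) (N - 1)) gamma)%R.
Proof.
move=> l0 mnl; split.
- move=> w wA; have [p [q [E lp nq hp]]] := Abar_turn _ _ _ _ _ l0 mnl wA.
  case: wA => [[wn wm] _ wN]; have := maj_turn p q lp.
  move: wn wm wN; rewrite E (gamma_turn _ _ lp nq).1 !count_cat /=.
  move=> wn wm wN mj; split.
  + by split; rewrite count_cat /=; lia.
  + exists (size p); first by rewrite size_cat leq_addr.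
    by rewrite height_catl //; lia.
  + by lia.
- move=> w w' /set_mem wA /set_mem wA'.
  have [p [q [-> lp nq _]]] := Abar_turn _ _ _ _ _ l0 mnl wA.
  have [p' [q' [-> lp' nq' _]]] := Abar_turn _ _ _ _ _ l0 mnl wA'.
  rewrite (gamma_turn _ _ lp nq).1 (gamma_turn _ _ lp' nq').1.
  by case/turn_uniq => // -> [->].
move=> w [[wn wm] [x xw hx] wN].
have hw := height_final w; rewrite wn wm in hw.
(* The final height [n - m + 2] exceeds [- l + 1], so the minimum is not at the end; for the same
   reason [q] is nonempty below. *)
case: (last_minimum w) => [/(_ x xw)|[p [q [E lp nq]]]]; first by lia.
have hp : (height p (size p) <= - l)%R.
  move: xw hx; rewrite E => /height_turn [[xp ->]|[y yq [_ ->]]].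
    by have := lp x xp; lia.
  by have := nq y yq; lia.
case: q E nq => [|b q] E nq.
  have := height_catr p [:: true] 1; rewrite height_cons height0 -E.
  rewrite (_ : size p + 1 = size w); last by rewrite E size_cat.
  by lia.
have := nonneg_cons _ _ nq; case: b E nq => // E nq _.
have mj := maj_turn p q lp; rewrite -E in mj.
exists (p ++ [:: false, true & q]); last by rewrite (gamma_turn _ _ lp nq).1.
move: wn wm; rewrite E !count_cat /= => wn wm; split.
- by split; rewrite count_cat /=; lia.
- exists (size p + 1); first by rewrite size_cat leq_add2l.
  by rewrite height_catr height_cons height0; lia.
- by lia.
Qed.

(** * Frobenius coordinates and the map f *)

Definition frobenius (mu : seq nat) (V : seq (nat * nat)) : Prop :=
  is_part mu /\ forall r c, (c < nth 0 mu r) = hook_cell V r c.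

(** The first [k] cells of row [k] belong to the legs of earlier hooks, long enough by
    [valleys_gap]; the others form the corner and arm of hook [k]. *)
Lemma frobenius_row w mu k : let V := valleys w in
  frobenius mu V -> k < size V -> nth 0 mu k = k + downs V k.
Proof.
move=> V [_ cmu] kV; apply: ltn_ext => c; rewrite cmu hook_cellE.
case: (leqP k c) => kc; first lia.
have := valleys_gap w c k; rewrite -/V (ltnW kc) kV => /(_ isT) []; lia.
Qed.

Lemma frobenius_col w mu k : let V := valleys w in
  frobenius mu V -> k < size V -> nth 0 (conj_part mu) k = k.+1 + ups V k.
Proof.
move=> V [pmu cmu] kV; apply: ltn_ext => c; rewrite nth_conj_gt // cmu hook_cellE.
case: (leqP c k) => kc; last lia.
have := valleys_gap w c k; rewrite -/V kc kV => /(_ isT) []; lia.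
Qed.

Lemma frobenius_durfee w mu : let V := valleys w in
  frobenius mu V -> durfee mu = size V.
Proof.
move=> V [pmu cmu]; apply: ltn_ext => k; rewrite durfee_gt // cmu hook_cellE leqnn subnn.
case: (ltnP k (size V)) => kV; last by rewrite downs_default.
by have := valleys_gap w k k; rewrite -/V leqnn kV => /(_ isT) [].
Qed.

Lemma frobenius_rank w mu k : let V := valleys w in
  frobenius mu V -> k < size V ->
  rank mu k.+1 = ((downs V k)%:Z - (ups V k)%:Z - 1)%R.
Proof.
move=> V muV kV; rewrite /rank /part /= (frobenius_row w) // (frobenius_col w) //.
rewrite -/V; lia.
Qed.

(** Rank [k + 1] of the conjugate is one more than the height of valley [k]. Valleys are listed from
    right to left, so the largest minimizing index is the leftmost lowest valley. *)
Lemma last_argmin_frobenius w mu s : let V := valleys w in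
  frobenius mu V -> s < size V ->
  (forall k, k < s -> ups V s + downs V k <= ups V k + downs V s) ->
  (forall k, s < k < size V -> ups V s + downs V k < ups V k + downs V s) ->
  last_argmin_rank (conj_part mu) = s.+1.
Proof.
move=> V muV sV sle slt; have [pmu _] := muV.
rewrite /last_argmin_rank durfee_conj // (frobenius_durfee w) // -/V.
have R k : k < size V -> rank (conj_part mu) k.+1 = ((ups V k)%:Z + 1 - (downs V k)%:Z)%R.
  by move=> kV; rewrite rank_conj // (frobenius_rank w) // -/V; lia.
apply: bigmax_last.
- apply/allP => -[|k]; rewrite mem_iota // add1n !ltnS => /andP[_ kV].
  rewrite !R //; case: (ltngtP k s) => [ks|ks|-> //].
  + by have := sle k ks; lia.
  + by have := slt k; rewrite ks kV => /(_ isT); lia.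
- by rewrite !ltnS.
case=> // k; rewrite !ltnS => /andP[sk kV]; apply/negP => /allP/(_ s.+1).
rewrite mem_iota add1n !ltnS sV !R // => /(_ isT).
by have := slt k; rewrite sk kV => /(_ isT); lia.
Qed.

(** The right-hand side is [f] seen on the conjugate diagram: rows [0] to [s] lose a cell (a column
    of length [s + 1] is removed), then columns [0] to [s - 1] gain one (a row of length [s] is
    inserted). *)
Lemma hook_turn w V' s : let V := valleys w in s < size V ->
  (forall k, ups V' k = ups V k + (k < s)) ->
  (forall k, downs V' k = downs V k - (k <= s)) ->
  ups V s < downs V s ->
  forall r c, hook_cell V' r c =
    if c < s then (r == 0) || hook_cell V r.-1 (c + (r.-1 <= s))
    else hook_cell V r (c + (r <= s)).
Proof.
move=> V sV Ha Hb abs r c.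
have G i j : i <= j -> j < size V ->
    [/\ ups V j + (j - i) <= ups V i, downs V j + (j - i) <= downs V i & 0 < downs V j].
  by move=> ij jV; apply: valleys_gap; rewrite ij.
rewrite !hook_cellE !Ha !Hb.
case: (ltnP c s) => cs.
  have [] := G c s (ltnW cs) sV.
  case: r => [|r] /=.
    have [] := G 0 s isT sV; lia.
  case: (leqP r s) => rs /=.
    have [] := G r s rs sV.
    have [] := G c.+1 s cs sV.
    case: (ltnP r s) => rs'; first (have [] := G r.+1 s rs' sV);
      rewrite ?addn1 ?addn0; case: ifP => H; case: ifP => H'; lia.
  rewrite addn0; case: ifP => H; first lia.
  by case: ifP => H'; lia.
case: (leqP r s) => rs /=.
  rewrite addn1; case: ifP => H; case: ifP => H'; lia.
rewrite !addn0; case: ifP => H; lia.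
Qed.

Lemma f_map_turn w mu V' mu' s : let V := valleys w in
  frobenius mu V -> frobenius mu' V' -> s < size V ->
  (forall k, ups V' k = ups V k + (k < s)) ->
  (forall k, downs V' k = downs V k - (k <= s)) ->
  ups V s < downs V s ->
  (forall k, k < s -> ups V s + downs V k <= ups V k + downs V s) ->
  (forall k, s < k < size V -> ups V s + downs V k < ups V k + downs V s) ->
  f_map (conj_part mu) = conj_part mu'.
Proof.
move=> V muV muV' sV Ha Hb abs sle slt.
rewrite /f_map (last_argmin_frobenius w mu s) //=.
have [pmu cmu] := muV; have [pmu' cmu'] := muV'.
have pla := conj_is_part _ (is_part_sorted _ pmu); set la := conj_part mu in pla *.
have cla r : count (leq r.+1) la = nth 0 mu r.
  by rewrite -nth_conj ?conjK // is_part_sorted.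
(* The part [s + 1] occurs because row [s] of [mu] is strictly longer than row [s + 1]. This follows
   from the strict inequality [slt] if there is a valley [s + 1], and from [abs] otherwise. *)
have sla : s.+1 \in la.
  have : count (leq s.+2) la < count (leq s.+1) la.
    rewrite !cla (frobenius_row w mu s) // -/V.
    suff : ~~ ((s + downs V s).-1 < nth 0 mu s.+1) by lia.
    rewrite cmu hook_cellE -/V.
    case: (ltnP s.+1 (size V)) => sV1; last first.
      rewrite (downs_default _ s.+1) //; case: ifP => H; first lia.
      by have -> : (s + downs V s).-1 = s; lia.
    have := slt s.+1; rewrite ltnSn sV1 => /(_ isT).
    by have := valleys_gap w s s.+1; rewrite -/V leqnSn sV1 => /(_ isT) []; case: ifP => H; lia.
  move=> lt; apply: contraLR lt => sN; rewrite -leqNgt.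
  apply/eq_leq/eq_in_count => x xla; rewrite [in RHS]ltn_neqAle.
  by case: eqP => // sx; rewrite sx xla in sN.
have snu : sorted geq (rem s.+1 la).
  exact: (subseq_sorted geq_trans (rem_subseq _ _) (is_part_sorted _ pla)).
have pnu : is_part (rem s.+1 la).
  rewrite /is_part snu; case/andP: pla => _; apply: contra; exact: mem_rem.
set nu := rem s.+1 la in snu pnu *.
(* Inserting a part [s] in the conjugate of [nu] adds 1 to each of the first [s] entries of [nu];
   both sides agree for [s = 0], when nothing is inserted. *)
have cX k : count (leq k.+1) (insert_part s (conj_part nu)) = (k < s) + nth 0 nu k.
  rewrite -[in RHS](conjK nu) // nth_conj ?is_part_sorted ?conj_is_part //.
  by case: (s) => //= s'; rewrite count_sort /=.
have sX : sorted geq (insert_part s (conj_part nu)).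
  case: (s) => [|s'] /=; first exact/is_part_sorted/conj_is_part.
  by apply: sort_sorted => x y; exact: leq_total.
apply: part_ext; first exact: conj_is_part.
  exact/conj_is_part/is_part_sorted.
move=> k; rewrite nth_conj // cX; apply: ltn_ext => r.
rewrite nth_conj_gt // cmu' (hook_turn w V' s) // -/V.
have cnu i : (i < nth 0 nu k) = hook_cell V i (k + (i <= s)).
  rewrite nth_sorted_gt // count_rem sla cla ltnS -cmu.
  by rewrite addnC ltn_subRL.
rewrite -!cnu; case: (k < s) => //=.
by case: r => [|r] /=; rewrite ?add1n ?ltnS.
Qed.

(** * The commutative diagram *)

Lemma word_foata_frobenius a b mu w : is_part mu -> word a b mu = foata w ->
  frobenius mu (valleys w) /\ sumn mu = maj w.
Proof.
move=> pmu E; have := word_parts_word a b mu pmu; rewrite E => Ew.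
split; last first.
  have := sumn_word_parts_foata (rev w); rewrite -/(foata w) -/(valleys w) Ew.
  by rewrite sumn_cat sumn_nseq mul0n addn0 maj_valleys.
split=> // r c; rewrite -word_parts_foata -/(foata w) Ew nth_cat nth_nseq if_same.
by case: (ltnP r (size mu)) => // rs; rewrite nth_default.
Qed.

Local Open Scope classical_set_scope.
Local Open Scope ring_scope.

(** * Bijectivity of the arrows of the diagram *)

Lemma set_bij_restrict (T U : Type) (A A' : set T) (B B' : set U) (f : T -> U) :
  set_bij A B f -> A' `<=` A -> B' `<=` B ->
  (forall x, A x -> A' x <-> B' (f x)) -> set_bij A' B' f.
Proof.
move=> [fAB injf surjf] sA sB H; split.
- by move=> x A'x; apply/H => //; exact: sA.
- move=> x y /set_mem A'x /set_mem A'y; apply: injf; apply/mem_set; exact: sA.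
- move=> y B'y; have [x Ax xy] := surjf _ (sB _ B'y).
  by exists x => //; apply/H; rewrite ?xy.
Qed.

(** This yields the bijectivity of [f_map] from that of the other sides of the diagram. *)
Lemma set_bij_factor (T U W : Type) (A : set T) (B : set U) (C : set W)
    (f : T -> U) (g : U -> W) (h : T -> W) :
  set_fun A B f -> set_bij B C g -> set_bij A C h ->
  (forall x, A x -> g (f x) = h x) -> set_bij A B f.
Proof.
move=> fAB [gBC injg surjg] [_ injh surjh] E; split=> //.
- move=> x y xA yA fxy; apply: injh => //.
  by rewrite -!E ?fxy //; exact: set_mem.
move=> y By; have [x Ax hx] := surjh _ (gBC _ By); exists x => //.
by apply: injg; rewrite ?inE; [exact: fAB|exact: By|rewrite E].
Qed.

Lemma phi_inv_bij (a b : int) : set_bij (Pbox a b) (Gpath a b) (phi_inv a b).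
Proof.
exact: set_bij_comp (word_bij a b) (bijpinv_bij _ (foata_bij a b)).
Qed.

Lemma foata_phi_inv (a b : int) mu : Pbox a b mu ->
  foata (phi_inv a b mu) = word a b mu.
Proof.
move=> Pmu; apply: pinvK; apply/mem_set.
by have [_ _] := foata_bij a b; apply; apply: word_path.
Qed.

Lemma phi_box (a b : int) w : Gpath a b w -> Pbox a b (phi a b w).
Proof.
move=> Gw; have [F _ _] := bijpinv_bij (fun=> [::]) (word_bij a b); apply: F.
by have [F _ _] := foata_bij a b; apply: F.
Qed.

Lemma word_phi (a b : int) w : Gpath a b w -> word a b (phi a b w) = foata w.
Proof.
move=> Gw; apply: pinvK; apply/mem_set.
have [_ _] := word_bij a b; apply.
by have [F _ _] := foata_bij a b; apply: F.
Qed.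

Lemma phi_invK (a b : int) w : Gpath a b w -> phi_inv a b (phi a b w) = w.
Proof.
move=> Gw; have Pw := phi_box _ _ _ Gw.
have [_ I _] := foata_bij a b; apply: I.
- by apply/mem_set; have [F _ _] := phi_inv_bij a b; apply: F.
- exact/mem_set.
by rewrite foata_phi_inv // word_phi.
Qed.

Lemma phi_inv_frobenius (a b : int) mu : Pbox a b mu ->
  frobenius mu (valleys (phi_inv a b mu)) /\ sumn mu = maj (phi_inv a b mu).
Proof.
move=> Pmu; apply: (word_foata_frobenius a b); first by case: Pmu.
by rewrite foata_phi_inv.
Qed.

(** Ranks are minus one minus the valley heights. Since the path does not end below [- l], a vertex
    below that line forces a valley below it. *)
Lemma frobenius_rank_gt w mu (l : int) : frobenius mu (valleys w) ->
  0 <= l -> - l <= height w (size w) ->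
  (exists2 i, (1 <= i <= durfee mu)%N & rank mu i > l - 1) <->
  (exists2 x, (x <= size w)%N & height w x < - l).
Proof.
move=> muV l0 hl; rewrite (frobenius_durfee w) //; split.
  case=> -[|k] // kV; rewrite (frobenius_rank w) // => rk.
  have := mem_nth (0%N, 0%N) kV => /height_valley[x xw hx].
  by exists x => //; rewrite hx -/(ups _ _) -/(downs _ _); lia.
case=> x xw hx.
have [|] := low_vertex_valley w (- l) x ltac:(by rewrite oppr_le0) xw hx.
  case=> v vV hv; exists (index v (valleys w)).+1; first by rewrite /= index_mem.
  rewrite (frobenius_rank w) ?index_mem // /ups /downs nth_index //.
  by case: v {vV} hv => va vb /=; lia.
by case=> _; rewrite ltNge hl.
Qed.

Lemma phi_inv_Rbar (a b l N : int) mu : 0 <= l -> b <= a + l -> Pbox a b mu ->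
  Rbar_le a b (l - 1) N mu <-> Abar a b (- l) N (phi_inv a b mu).
Proof.
move=> l0 bal Pmu; have [muV smu] := phi_inv_frobenius _ _ _ Pmu.
have [F _ _] := phi_inv_bij a b; have Gw := F _ Pmu.
have hl : - l <= height (phi_inv a b mu) (size (phi_inv a b mu)).
  by rewrite height_final; case: Gw => -> ->; lia.
have R := frobenius_rank_gt _ _ _ muV l0 hl.
split; first by move=> [[_ sN] /R H]; split=> //; rewrite -smu.
by move=> [_ /R H mN]; split=> //; split=> //; rewrite smu.
Qed.

Lemma phi_inv_Rbar_bij (a b l N : int) : 0 <= l -> b <= a + l ->
  set_bij (Rbar_le a b (l - 1) N) (Abar a b (- l) N) (phi_inv a b).
Proof.
move=> l0 bal; apply: (set_bij_restrict _ _ _ _ _ _ _ (phi_inv_bij a b)).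
- by move=> mu [[]].
- by move=> w [].
- by move=> mu; apply: phi_inv_Rbar.
Qed.

Lemma phi_inv_box (a b N : int) mu : Pbox a b mu ->
  PboxN a b N mu <-> Abar a b 1 N (phi_inv a b mu).
Proof.
move=> Pmu; have [_ smu] := phi_inv_frobenius _ _ _ Pmu.
have [F _ _] := phi_inv_bij a b; have Gw := F _ Pmu.
split=> [[_ sN]|[_ _ mN]]; split; rewrite ?smu // -?smu //.
by exists 0%N; rewrite ?height0.
Qed.

Lemma phi_inv_box_bij (a b N : int) :
  set_bij (PboxN a b N) (Abar a b 1 N) (phi_inv a b).
Proof.
apply: (set_bij_restrict _ _ _ _ _ _ _ (phi_inv_bij a b)).
- by move=> mu [].
- by move=> w [].
- by move=> mu; apply: phi_inv_box.
Qed.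

Lemma conj_bij (a b : int) : set_bij (Pbox a b) (Pbox b a) conj_part.
Proof.
have F c d : set_fun (Pbox c d) (Pbox d c) conj_part.
  move=> la [pla sa sb]; split; first exact/conj_is_part/is_part_sorted.
    by rewrite conj_size.
  by rewrite conj_part1.
split; first exact: F.
  move=> la mu /set_mem [pla _ _] /set_mem [pmu _ _] E.
  by rewrite -(conjK la) // E conjK.
move=> mu Pmu; exists (conj_part mu); first exact: F.
by case: Pmu => pmu _ _; exact: conjK.
Qed.

Lemma conj_box_bij (a b N : int) : set_bij (PboxN a b N) (PboxN b a N) conj_part.
Proof.
apply: (set_bij_restrict _ _ _ _ _ _ _ (conj_bij a b)) => [la []//|la []//|la Pla].
have [F _ _] := conj_bij a b; have [pla _ _] := Pla.
by split=> -[_ sN]; split; rewrite ?conj_sumn // -?(conj_sumn la) //; exact: F.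
Qed.

Lemma conj_Rbar_bij (a b c N : int) :
  set_bij (Rbar_ge a b c N) (Rbar_le b a (- c) N) conj_part.
Proof.
apply: (set_bij_restrict _ _ _ _ _ _ _ (conj_box_bij a b N)) => [la []//|la []//|la Pla].
have [F _ _] := conj_box_bij a b N; have [[pla _ _] _] := Pla.
split=> -[_ [i id ri]]; split=> //; try exact: F; exists i.
- by rewrite durfee_conj.
- by rewrite rank_conj // ltrN2.
- by rewrite -durfee_conj.
- by rewrite -ltrN2 -rank_conj.
Qed.

Lemma f_map_gamma (m n l N : int) la : 0 <= l -> m <= n + l ->
  Rbar_ge m n (1 - l) N la ->
  let w := gamma (phi_inv n m (conj_part la)) in
  Gpath (n + 1) (m - 1) w /\ f_map la = conj_part (phi (n + 1) (m - 1) w).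
Proof.
move=> l0 mnl laR.
have [[pla _ _] _] := laR.1.
have muR : Rbar_le n m (l - 1) N (conj_part la).
  by rewrite -opprB; have [F _ _] := conj_Rbar_bij m n (1 - l) N; apply: F.
have Pmu := muR.1.1; have [muV _] := phi_inv_frobenius _ _ _ Pmu.
have wA := (phi_inv_Rbar _ _ _ _ _ l0 mnl Pmu).1 muR.
have [F _ _] := gamma_bij n m l N l0 mnl; have [Gw _ _] := F _ wA.
split=> //; move: muV Gw.
have [p [q [-> lp nq _]]] := Abar_turn _ _ _ _ _ l0 mnl wA.
rewrite (gamma_turn _ _ lp nq).1 => muV Gw.
have [s sV [Ha Hb abs sle slt]] := valleys_turn _ _ lp nq.
rewrite -[in LHS](conjK la) //; apply: (f_map_turn _ _ _ _ s muV _ sV Ha Hb) => //.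
have Pw := phi_box _ _ _ Gw.
by have [] := phi_inv_frobenius _ _ _ Pw; rewrite phi_invK.
Qed.

(** The target [B] is left open to cover both [0 < l], with a rank condition, and [l = 0], without
    one. *)
Lemma f_map_bij (m n l N : int) (B : set (seq nat)) : 0 <= l -> m <= n + l ->
  let A' := Abar (n + 1) (m - 1) (- l + 1) (N - 1) in
  set_bij B A' (phi_inv (n + 1) (m - 1) \o conj_part) ->
  (forall mu, Pbox (n + 1) (m - 1) mu -> A' (phi_inv (n + 1) (m - 1) mu) ->
     B (conj_part mu)) ->
  set_bij (Rbar_ge m n (1 - l) N) B f_map.
Proof.
move=> l0 mnl A' bijB HB.
have cb := conj_Rbar_bij m n (1 - l) N; rewrite opprB in cb.
have hb := set_bij_comp cb (set_bij_comp (phi_inv_Rbar_bij n m l N l0 mnl)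
  (gamma_bij n m l N l0 mnl)).
apply: (set_bij_factor _ _ _ _ _ _ _ _ _ _ bijB hb).
  move=> la laR; have [Gw ->] := f_map_gamma _ _ _ _ _ l0 mnl laR.
  apply: HB; first exact: phi_box.
  by rewrite phi_invK //; have [F _ _] := hb; exact: (F _ laR).
move=> la laR; have [Gw E] := f_map_gamma _ _ _ _ _ l0 mnl laR.
by rewrite /= E conjK ?phi_invK //; have [] := phi_box _ _ _ Gw.
Qed.

Theorem theorem6p5 (m n l N : int)
    (hm : 0 <= m) (hn : 0 <= n) (hl : 0 <= l) (hN : 0 <= N)
    (hnl : m <= n + l) :
  [/\ (* the relation between f and gamma, and commutation of the diagram *)
      forall la : seq nat, Rbar_ge m n (1 - l) N la ->
        f_map la
          = conj_part (phi (n + 1) (m - 1) (gamma (phi_inv n m (conj_part la))))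
        /\ phi_inv (n + 1) (m - 1) (conj_part (f_map la))
             = gamma (phi_inv n m (conj_part la)),
      (* the top row and the right column *)
      [/\ set_bij (Rbar_ge m n (1 - l) N) (Rbar_le n m (l - 1) N) conj_part,
          set_bij (Rbar_le n m (l - 1) N) (Abar n m (- l) N) (phi_inv n m) &
          set_bij (Abar n m (- l) N) (Abar (n + 1) (m - 1) (- l + 1) (N - 1))
            gamma],
      (* the left column and the bottom row *)
      0 < l ->
      [/\ set_bij (Rbar_ge m n (1 - l) N)
            (Rbar_ge (m - 1) (n + 1) (2 - l) (N - 1)) f_map,
          set_bij (Rbar_ge (m - 1) (n + 1) (2 - l) (N - 1))
            (Rbar_le (n + 1) (m - 1) (l - 2) (N - 1)) conj_part &
          set_bij (Rbar_le (n + 1) (m - 1) (l - 2) (N - 1))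
            (Abar (n + 1) (m - 1) (- l + 1) (N - 1)) (phi_inv (n + 1) (m - 1))]
    & (* for l = 0 the condition on ranks in the bottom row is void: every path
         starts below the line y = 1 *)
      l = 0 ->
      [/\ set_bij (Rbar_ge m n (1 - l) N)
            (PboxN (m - 1) (n + 1) (N - 1)) f_map,
          set_bij (PboxN (m - 1) (n + 1) (N - 1))
            (PboxN (n + 1) (m - 1) (N - 1)) conj_part &
          set_bij (PboxN (n + 1) (m - 1) (N - 1))
            (Abar (n + 1) (m - 1) (- l + 1) (N - 1)) (phi_inv (n + 1) (m - 1))]].
Proof.
split.
- move=> la laR; have [Gw E] := f_map_gamma _ _ _ _ _ hl hnl laR.
  by rewrite E conjK ?phi_invK //; have [] := phi_box _ _ _ Gw.
- split; last exact: gamma_bij.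
    by have := conj_Rbar_bij m n (1 - l) N; rewrite opprB.
  exact: phi_inv_Rbar_bij.
- move=> l0; have cb := conj_Rbar_bij (m - 1) (n + 1) (2 - l) (N - 1).
  rewrite opprB in cb.
  (* The bottom row is an instance of the top row, for [n + 1], [m - 1] and [l - 1]. *)
  have l'0 : 0 <= l - 1 by lia.
  have mnl : m - 1 <= n + 1 + (l - 1) by lia.
  have [E1 E2] : l - 1 - 1 = l - 2 /\ - (l - 1) = - l + 1 by lia.
  have pb := phi_inv_Rbar_bij _ _ _ (N - 1) l'0 mnl; rewrite E1 E2 in pb.
  split=> //; apply: f_map_bij => //; first exact: set_bij_comp cb pb.
  move=> mu Pmu; rewrite -E2 => /(phi_inv_Rbar _ _ _ _ _ l'0 mnl Pmu).
  have := conj_Rbar_bij (m - 1) (n + 1) (2 - l) (N - 1); rewrite opprB E1.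
  case=> _ _ S /S [la laR <-]; rewrite conjK //; by case: laR => -[[]].
move=> l0; have cb := conj_box_bij (m - 1) (n + 1) (N - 1).
have pb := phi_inv_box_bij (n + 1) (m - 1) (N - 1).
have E : - l + 1 = 1 by rewrite l0.
rewrite E; split=> //; apply: f_map_bij => //; rewrite E.
  exact: set_bij_comp cb pb.
move=> mu Pmu /(phi_inv_box _ _ _ _ Pmu) muN.
by have [F _ _] := conj_box_bij (n + 1) (m - 1) (N - 1); apply: F.
Qed.
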